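(* Let $N\ge 1$ be an integer and let $\mu:\mathbb{R}^N\to[0,\infty)$ be a function such that $\sqrt{\mu}\in H^1_{loc}(\mathbb{R}^N)$, $\nabla\mu\in L^1_{loc}(\mathbb{R}^N)$ and $\mu^{-1}\in L^1_{loc}(\mathbb{R}^N)$. Suppose there are constants $k_1,k_2\in\mathbb{R}$ with $k_2>2-N$ such that, with $\alpha_o=-\frac{N+k_2-2}{2}$, for every $\varepsilon>0$ $$\frac{\alpha_o\, x}{\varepsilon+|x|^2}\cdot\nabla\mu(x)\le\left(k_1+\frac{k_2\,\alpha_o}{\varepsilon+|x|^2}\right)\mu(x)\qquad\text{for a.e. }x\in\mathbb{R}^N.$$ Suppose moreover that, for $\delta\in\mathbb{R}$, $$\frac{\mu(x)}{|x|^\delta}\in L^1_{loc}(\mathbb{R}^N)\quad\text{if and only if}\quad \delta<N+k_2 .$$ If $c>c_o(N+k_2)=\left(\frac{N+k_2-2}{2}\right)^2$, then the inequality $$c\int_{\mathbb{R}^N}\frac{\varphi^2}{|x|^2}\,d\mu\le\int_{\mathbb{R}^N}|\nabla\varphi|^2\,d\mu+k_1\int_{\mathbb{R}^N}\varphi^2\,d\mu\qquad\forall\,\varphi\in H^1_\mu$$ fails, i.e. there exists $\varphi\in H^1_\mu$ for which it does not hold.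
   Context: Functions are real valued and $d\mu=\mu(x)\,dx$. $L^2_\mu=L^2(\mathbb{R}^N,\mu(x)\,dx)$. The weighted Sobolev space $H^1_\mu=H^1(\mathbb{R}^N,\mu(x)\,dx)$ is the space of functions in $L^2_\mu$ whose weak first derivatives belong to $L^2_\mu$. $\nabla\mu$ is the weak gradient. $L^1_{loc}(\mathbb{R}^N)$ is with respect to Lebesgue measure and includes integrability near the origin. The inequality is regarded as failing for $\varphi$ also when its left-hand side is $+\infty$ (the right-hand side is finite). *)

(* Defs.v *)
From HB Require Import structures.
From mathcomp Require Import all_boot all_order all_algebra.
From mathcomp Require Import all_classical all_reals all_analysis.
From mathcomp Require Import measurable_realfun.

Set Implicit Arguments.
Unset Strict Implicit.
Unset Printing Implicit Defensive.

Import Order.TTheory GRing.Theory Num.Theory.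
Import numFieldNormedType.Exports.

Local Open Scope classical_set_scope.
Local Open Scope ring_scope.

(* As for tuples in the library, the sigma-algebra on row vectors is generated
   by the coordinates; over a realType this is the Borel sigma-algebra. *)
Definition measure_rV_display : measure_display -> measure_display.
Proof. exact. Qed.

Section measurable_rV.
Context {d} {T : sigmaRingType d} (n : nat).

Let coords (i : 'I_n) (v : 'rV[T]_n) : T := v ord0 i.

Let rV_set0 : g_sigma_preimage coords set0.
Proof. exact: sigma_algebra0. Qed.

Let rV_setC A : g_sigma_preimage coords A -> g_sigma_preimage coords (~` A).
Proof. exact: sigma_algebraC. Qed.

Let rV_bigcup (F : _^nat) : (forall i, g_sigma_preimage coords (F i)) ->
  g_sigma_preimage coords (\bigcup_i (F i)).
Proof. exact: sigma_algebra_bigcup. Qed.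

HB.instance Definition _ := @isMeasurable.Build (measure_rV_display d)
  'rV[T]_n (g_sigma_preimage coords) rV_set0 rV_setC rV_bigcup.

End measurable_rV.

Lemma measurable_coord d (T : sigmaRingType d) n (i : 'I_n) :
  measurable_fun [set: 'rV[T]_n] (fun v : 'rV[T]_n => v ord0 i).
Proof.
move=> _ Y mY; rewrite setTI; apply: sub_sigma_algebra => /=.
rewrite -bigcup_seq/=; exists i => /=; first by rewrite mem_index_enum.
by exists Y => //; rewrite setTI.
Qed.

Lemma measurable_fun_coordP d1 d2 (T1 : measurableType d1)
    (T2 : measurableType d2) n (f : T1 -> 'rV[T2]_n) :
  measurable_fun [set: T1] f <->
  forall i, measurable_fun [set: T1] (fun x => f x ord0 i).
Proof.
pose coord (i : 'I_n) (v : 'rV[T2]_n) := v ord0 i.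
apply: (@iff_trans _ (g_sigma_preimage (fun i => coord i \o f) `<=` measurable)).
  rewrite g_sigma_preimage_comp; split=> [mf A [/= C preC <-]|prefS].
    exact: mf.
  by move=> _ A mA; apply: prefS; exists A.
split=> [fS i|mf].
- move=> _ A mA.
  apply: fS; apply: sub_sigma_algebra.
  rewrite -bigcup_seq/=; exists i => /=; first by rewrite mem_index_enum.
  by exists A.
- apply: smallest_sub; first exact: sigma_algebra_measurable.
  rewrite -bigcup_seq/=; apply: bigcup_sub => i _.
  by move=> A [B mB <-]; exact: mf.
Qed.

Section rV_cons.
Context {R : realType} {n : nat}.

Definition rV_cons (p : R * 'rV[R]_n) :
    'rV[R]_n.+1 :=
  \row_(i < n.+1) if unlift ord0 i is Some j then p.2 ord0 j else p.1.

Definition rV_uncons (v : 'rV[R]_n.+1) :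
    R * 'rV[R]_n :=
  (v ord0 ord0, \row_(j < n) v ord0 (lift ord0 j)).

Lemma rV_consK : cancel rV_cons rV_uncons.
Proof.
move=> [x v]; rewrite /rV_uncons /rV_cons mxE unlift_none /=; congr pair.
by apply/rowP => j; rewrite !mxE liftK.
Qed.

Lemma measurable_rV_cons : measurable_fun [set: _] rV_cons.
Proof.
apply/measurable_fun_coordP => i; rewrite /rV_cons.
under eq_fun do rewrite mxE.
case: unliftP => [j|] _; last exact: measurable_fst.
exact: (measurableT_comp (measurable_coord j) measurable_snd).
Qed.

Lemma measurable_rV_uncons : measurable_fun [set: _] rV_uncons.
Proof.
apply/measurable_fun_pairP; split; first exact: measurable_coord.
apply/measurable_fun_coordP => j /=.
under eq_fun do rewrite mxE.
exact: measurable_coord.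
Qed.

End rV_cons.

Section rV_measure_cons.
Local Open Scope ereal_scope.
Context {R : realType} {n : nat}.
Variable m : {sigma_finite_measure set 'rV[R]_n -> \bar R}.

Definition rV_measure_cons : set 'rV[R]_n.+1 -> \bar R :=
  pushforward (lebesgue_measure \x m) rV_cons.

Let rV_measure_cons0 : rV_measure_cons set0 = 0.
Proof. by rewrite /rV_measure_cons /pushforward preimage_set0 measure0. Qed.

Let rV_measure_cons_ge0 A : 0 <= rV_measure_cons A.
Proof. by rewrite /rV_measure_cons /pushforward measure_ge0. Qed.

Let rV_measure_cons_sigma_additive : semi_sigma_additive rV_measure_cons.
Proof.
move=> F mF tF mUF; rewrite /rV_measure_cons /pushforward preimage_bigcup.
apply: measure_semi_sigma_additive.
- by move=> i; rewrite -[X in measurable X]setTI; exact: measurable_rV_cons.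
- apply/trivIsetP => /= i j _ _ ij; rewrite -preimage_setI.
  by move/trivIsetP : tF => /(_ _ _ _ _ ij) ->//; rewrite preimage_set0.
- rewrite -preimage_bigcup -[X in measurable X]setTI.
  exact: measurable_rV_cons.
Qed.

HB.instance Definition _ := isMeasure.Build _ _ _ rV_measure_cons
  rV_measure_cons0 rV_measure_cons_ge0 rV_measure_cons_sigma_additive.

Let rV_measure_cons_sigma_finite : sigma_finite setT rV_measure_cons.
Proof.
have /sigma_finiteP[F [TF ndF Foo]] :=
  sigma_finiteT (@lebesgue_measure R : {sigma_finite_measure set _ -> \bar R}).
have /sigma_finiteP[G [TG ndG Goo]] := sigma_finiteT m.
have FGT : \bigcup_k (F k `*` G k) = setT.
  apply/seteqP; split => // -[x y] _.
  have : [set: R] x by []. rewrite TF => -[i _ Fx].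
  have : [set: 'rV[R]_n] y by []. rewrite TG => -[j _ Gy].
  exists (maxn i j) => //; split => /=.
    by move: x Fx; exact/subsetPset/ndF/leq_maxl.
  by move: y Gy; exact/subsetPset/ndG/leq_maxr.
exists (fun k => rV_uncons @^-1` (F k `*` G k)).
  by rewrite -preimage_bigcup FGT preimage_setT.
move=> k; have [mF Fkoo] := Foo k; have [mG Gkoo] := Goo k; split.
  rewrite -[X in measurable X]setTI; apply: measurable_rV_uncons => //.
  exact: measurableX.
rewrite /rV_measure_cons /pushforward -comp_preimage.
rewrite (_ : rV_uncons \o rV_cons = id); last exact/funext/rV_consK.
rewrite preimage_id product_measure1E//.
by rewrite lte_mul_pinfty// ge0_fin_numE.
Qed.

HB.instance Definition _ := Measure_isSigmaFinite.Build _ _ _ rV_measure_cons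
  rV_measure_cons_sigma_finite.

End rV_measure_cons.

(* Iterated product measure on the Borel sets. *)
Fixpoint borel_lebesgue_rV {R : realType} n :
    {sigma_finite_measure set 'rV[R]_n -> \bar R} :=
  if n is n'.+1 then rV_measure_cons (borel_lebesgue_rV n')
  else dirac (0 : 'rV[R]_0).

(* A copy of 'rV[R]_n carrying the Lebesgue-measurable sets, i.e. the completion
   of the sigma-algebra above; lebesgue_rV_box below checks the normalization. *)
Definition lebesgue_rV_type (R : realType) n : Type :=
  caratheodory_type ((@borel_lebesgue_rV R n)^*)%mu.
HB.instance Definition _ (R : realType) n :=
  Measurable.copy (lebesgue_rV_type R n)
    (caratheodory_type ((@borel_lebesgue_rV R n)^*)%mu).

Definition lebesgue_rV {R : realType} n : set (lebesgue_rV_type R n) -> \bar R :=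
  @completed_measure_extension _ _ _ (@borel_lebesgue_rV R n).
HB.instance Definition _ (R : realType) n := Measure.on (@lebesgue_rV R n).

Section lebesgue_rV_box.
Local Open Scope ereal_scope.
Context {R : realType}.

Lemma measurable_box n (A : 'I_n -> set R) : (forall i, measurable (A i)) ->
  measurable [set v : 'rV[R]_n | forall i, A i (v ord0 i)].
Proof.
move=> mA.
have -> : [set v : 'rV[R]_n | forall i, A i (v ord0 i)] =
    \bigcap_(i in [set: 'I_n]) ((fun v : 'rV[R]_n => v ord0 i) @^-1` A i).
  by apply/seteqP; split=> v /= Av i; [move=> _|]; exact: Av.
apply: fin_bigcap_measurable => // i _.
by rewrite -[X in measurable X]setTI; exact: measurable_coord.
Qed.

Lemma borel_lebesgue_rV_box n (A : 'I_n -> set R) :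
  (forall i, measurable (A i)) ->
  borel_lebesgue_rV n [set v : 'rV[R]_n | forall i, A i (v ord0 i)] =
  \prod_(i < n) lebesgue_measure (A i).
Proof.
elim: n A => [|n IHn] A mA.
  rewrite big_ord0 /= diracE mem_set//=; by case.
rewrite big_ord_recl /= -IHn// /rV_measure_cons /pushforward -product_measure1E//.
  congr (_ \x _); apply/seteqP; split => [[x v] /= Axv|[x v] [/= Ax Av] i].
    split => [|i]; first by have := Axv ord0; rewrite mxE unlift_none.
    by have := Axv (lift ord0 i); rewrite mxE liftK.
  by rewrite mxE; case: unliftP => [j ->|->].
- exact: mA.
- exact: (@measurable_box n (fun i => A (lift ord0 i))).
Qed.

Lemma lebesgue_rV_borel n (A : set 'rV[R]_n) : measurable A ->
  lebesgue_rV A = borel_lebesgue_rV n A.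
Proof. exact: measurable_mu_extE. Qed.

Lemma lebesgue_rV_box n (A : 'I_n -> set R) : (forall i, measurable (A i)) ->
  lebesgue_rV [set v : 'rV[R]_n | forall i, A i (v ord0 i)] =
  \prod_(i < n) lebesgue_measure (A i).
Proof.
by move=> mA; rewrite lebesgue_rV_borel ?borel_lebesgue_rV_box//; exact: measurable_box.
Qed.

End lebesgue_rV_box.

Section euclidean.
Context {R : realType} {n : nat}.
Implicit Types x y : 'rV[R]_n.

Definition dotv x y : R := \sum_i x ord0 i * y ord0 i.

(* The norm `|x| of the library is the sup norm. *)
Definition enorm x : R := Num.sqrt (dotv x x).

End euclidean.

Section local_integrability.
Local Open Scope ereal_scope.
Context {R : realType} {n : nat}.

(* Extended-real valued so that mu^-1 can be +oo where mu vanishes. *)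
Definition L1_loc (f : 'rV[R]_n -> \bar R) : Prop :=
  measurable_fun [set: lebesgue_rV_type R n] f /\
  forall K : set 'rV[R]_n, compact K ->
    \int[@lebesgue_rV R n]_(x in K) `|f x| < +oo.

Definition L2_loc (f : 'rV[R]_n -> R) : Prop :=
  measurable_fun [set: lebesgue_rV_type R n] f /\
  forall K : set 'rV[R]_n, compact K ->
    \int[@lebesgue_rV R n]_(x in K) (f x ^+ 2)%:E < +oo.

Definition L2_weighted (mu f : 'rV[R]_n -> R) : Prop :=
  measurable_fun [set: lebesgue_rV_type R n] f /\
  \int[@lebesgue_rV R n]_x (f x ^+ 2 * mu x)%:E < +oo.

End local_integrability.

Section weak_derivatives.
Context {R : realType} {n : nat}.
Implicit Types (f psi mu : 'rV[R]_n -> R) (g : 'rV[R]_n -> 'rV[R]_n).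

Definition partial_deriv (i : 'I_n) f : 'rV[R]_n -> R :=
  fun x => 'D_(delta_mx ord0 i) f x.

Definition iter_partial (s : seq 'I_n) f : 'rV[R]_n -> R := foldr partial_deriv f s.

(* C^infty: the partial derivatives of every order exist and are continuous. *)
Definition smooth f : Prop := forall s : seq 'I_n,
  continuous (iter_partial s f) /\
  forall i x, derivable (iter_partial s f) x (delta_mx ord0 i).

Definition test_function psi : Prop :=
  smooth psi /\ compact (closure [set x | psi x != 0]).

Definition weak_gradient f g : Prop :=
  L1_loc (EFin \o f) /\
  forall i, L1_loc (fun x => (g x ord0 i)%:E) /\
    forall psi, test_function psi ->
      (\int[@lebesgue_rV R n]_x (f x * partial_deriv i psi x)%:E =
       - \int[@lebesgue_rV R n]_x (g x ord0 i * psi x)%:E)%E.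

Definition H1_loc f : Prop := L2_loc f /\
  exists g, weak_gradient f g /\ forall i, L2_loc (fun x => g x ord0 i).

Definition H1_weighted mu f : Prop := L2_weighted mu f /\
  exists g, weak_gradient f g /\ forall i, L2_weighted mu (fun x => g x ord0 i).

End weak_derivatives.

Definition alpha_o {R : realType} (N : nat) (k2 : R) : R :=
  - ((N%:R + k2 - 2) / 2).

Definition c_o {R : realType} (t : R) : R := ((t - 2) / 2) ^+ 2.

(* gphi is meant to be the weak gradient of phi. Both sides are extended reals:
   the left-hand side may be +oo. The junk value of phi x ^+ 2 / enorm x ^+ 2
   at 0 is on a null set. *)
Definition hardy_inequality {R : realType} {N : nat} (mu : 'rV[R]_N -> R)
    (c k1 : R) (phi : 'rV[R]_N -> R) (gphi : 'rV[R]_N -> 'rV[R]_N) : Prop :=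
  (c%:E * \int[@lebesgue_rV R N]_x (phi x ^+ 2 / enorm x ^+ 2 * mu x)%:E <=
   \int[@lebesgue_rV R N]_x (enorm (gphi x) ^+ 2 * mu x)%:E +
   k1%:E * \int[@lebesgue_rV R N]_x (phi x ^+ 2 * mu x)%:E)%E.

(* Main.v *)
Require Import Defs.
From mathcomp Require Import all_boot all_order all_algebra.
From mathcomp Require Import all_classical all_reals all_analysis.
From mathcomp Require Import measurable_realfun.
From mathcomp Require Import ring lra.

Import Order.TTheory GRing.Theory Num.Theory.
Import numFieldNormedType.Exports.

Local Open Scope classical_set_scope.
Local Open Scope ring_scope.

(** The constant is tested on regularizations of the critical power [|x|^-t],
    where [t = (N + k2 - 2) / 2] is the positive square root of the critical
    constant. The hypothesis on the weights [mu / |x|^delta] says that [|x|^(-2t)] is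
    locally integrable with respect to [mu], since [2t < N + k2], whereas
    [|x|^(-2t - 2)] is not, since [2t + 2] is the threshold [N + k2] itself.

    Let [phi_eps x = (eps + |x|^2)^(-t/2) * (max 0 (1 - |x|^2))^2]. It is of class
    C^1 and supported in the unit ball, hence in the weighted Sobolev space, with
    its classical gradient as weak gradient ([weak_gradient_trial]); this rests on
    the vanishing of the integral of a compactly supported partial derivative
    ([integral_partial_eq0]). Up to terms controlled by [|x|^(-2t)] on the unit
    ball, its squared gradient is at most [t^2 phi_eps^2 / |x|^2]
    ([dprofile_sqr_le]). If the inequality held for every [phi_eps] with a constant
    [c > t^2], the difference [c - t^2] would bound the integrals of
    [phi_eps^2 / |x|^2] uniformly in [eps] ([hardy_trial_bound]). By monotone
    convergence [|x|^(-2t - 2)] would then be integrable near the origin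
    ([singular_weight_le]), hence locally integrable ([L1_loc_powR_of_ball]), which
    is excluded. *)

(** * Borel sets and Lebesgue-measurable sets of row vectors *)

(** The sup norm makes balls into boxes, which the coordinates generate; an open
    set is the union of the countably many boxes of rational centre and radius
    [1/(k+1)] that it contains. *)
Lemma measurable_open_rV {R : realType} {n : nat} (U : set 'rV[R]_n) :
  open U -> measurable U.
Proof.
move=> oU.
pose B (p : 'rV[rat]_n * nat) : set 'rV[R]_n :=
  [set v | forall i, (ball (ratr (p.1 ord0 i) : R) (p.2.+1%:R^-1)) (v ord0 i)].
have mB p : measurable (B p).
  apply: (@measurable_box R n (fun i => ball (ratr (p.1 ord0 i) : R) (p.2.+1%:R^-1))).
  by move=> i; exact: measurable_ball.
have -> : U = \bigcup_(p in [set p | B p `<=` U]) B p.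
  apply/seteqP; split => [v Uv|v [p /= BU Bv]]; last exact: BU.
  have /nbhs_ballP[e /= e0 eU] : nbhs v U by exact: open_nbhs_nbhs.
  have [k ke] : exists k, 2 * k.+1%:R^-1 < e.
    have [k _ kP] := near_infty_natSinv_lt (PosNum (divr_gt0 e0 (ltr0Sn R 1))).
    exists k. by have := kP k (leqnn k); rewrite /= ltr_pdivlMr// mulrC.
  have k0 : 0 < k.+1%:R^-1 :> R by rewrite invr_gt0.
  have q_ (i : 'I_n) : {q : rat | ball (ratr q : R) (k.+1%:R^-1) (v ord0 i)}.
    apply: cid; move: k0; set d := _^-1 => d0.
    have : v ord0 i - d < v ord0 i + d by lra.
    move=> /rat_in_itvoo[q]; rewrite in_itv /= => /andP[h1 h2].
    exists q; rewrite -ball_normE /ball_ /= ltr_norml.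
    by apply/andP; split; [rewrite ltrBrDl; exact: h1|rewrite ltrBlDl; exact: h2].
  exists (\row_i sval (q_ i), k); rewrite /B /=.
  - move=> w /= Bw; apply: eU; split => // i j.
    rewrite !ord1; have := Bw j; rewrite mxE; case: (q_ j) => q /= h1 h2.
    have h3 := ball_triangle (ball_sym h1) h2.
    by apply: le_ball h3; move: ke; set d := _^-1 => ke; lra.
  - by move=> i; rewrite mxE; case: (q_ i).
rewrite bigcup_mkcond.
rewrite (_ : \bigcup_p _ = \bigcup_(k in [set: nat])
   (if unpickle k is Some p then
    (if p \in [set p | B p `<=` U] then B p else set0) else set0)); last first.
  apply/seteqP; split => [v [p _ h]|v [k _]].
    by exists (pickle p) => //; rewrite pickleK.
  by case: unpickle => // p h; exists p.
apply: bigcup_measurable => k _; case: unpickle => // p; case: ifP => // _.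
Qed.

Lemma measurable_lebesgue_rV {R : realType} {n : nat} (A : set 'rV[R]_n) :
  measurable A -> @measurable _ (lebesgue_rV_type R n) A.
Proof. by move=> mA; exact: caratheodory_measurable_mu_ext. Qed.

Lemma measurable_continuous_rV {R : realType} {n : nat} (f : 'rV[R]_n -> R) :
  continuous f -> measurable_fun [set: 'rV[R]_n] f.
Proof.
move=> /continuousP cf; apply: (measurability _ (RGenOpens.measurableE R)).
move=> _ [_ [a [b ->] <-]]; rewrite setTI; apply: measurable_open_rV.
exact/cf/interval_open.
Qed.

Lemma measurable_fun_lebesgue_rV {R : realType} {n : nat} {d} {T : measurableType d}
    (f : 'rV[R]_n -> T) : measurable_fun [set: 'rV[R]_n] f ->
  measurable_fun [set: lebesgue_rV_type R n] f.
Proof.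
move=> mf mT Y mY; rewrite setTI; apply: measurable_lebesgue_rV.
by rewrite -[X in measurable X]setTI; exact: mf.
Qed.

Lemma compact_measurable_rV {R : realType} {n : nat} (K : set 'rV[R]_n) :
  compact K -> measurable K.
Proof.
move=> cK; rewrite -(setCK K); apply: measurableC; apply: measurable_open_rV.
by apply: closed_openC; apply: compact_closed => //; exact: norm_hausdorff.
Qed.

(** Fubini's theorem applies to the iterated product measure, which is the image
    of its completion under the identity; integrals of Borel functions can
    therefore be computed with it. *)
Lemma integral_lebesgue_borel {R : realType} {n : nat} (f : 'rV[R]_n -> \bar R) :
  measurable_fun [set: 'rV[R]_n] f ->
  (\int[@lebesgue_rV R n]_x f x = \int[borel_lebesgue_rV n]_x f x)%E.
Proof.
move=> mf.
have mid : measurable_fun [set: lebesgue_rV_type R n]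
    (id : lebesgue_rV_type R n -> 'rV[R]_n).
  exact: measurable_fun_lebesgue_rV.
have ge0E (g : 'rV[R]_n -> \bar R) : measurable_fun [set: 'rV[R]_n] g ->
    (forall x, 0 <= g x)%E ->
    (\int[@lebesgue_rV R n]_x g x = \int[borel_lebesgue_rV n]_x g x)%E.
  move=> mg g0.
  have := @ge0_integral_pushforward _ _ _ _ R _ mid (@lebesgue_rV R n) setT g
    measurableT mg (fun y _ => g0 y).
  rewrite preimage_setT => <-; apply: eq_measure_integral => A mA _.
  exact: lebesgue_rV_borel.
rewrite integralE [RHS]integralE; congr (_ - _)%E; apply: ge0E => //.
- exact: measurable_funepos.
- exact: measurable_funeneg.
Qed.

(** * The integral of a partial derivative vanishes *)

(** A directional derivative depends only on the restriction of the function to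
    the line through the point; this turns partial derivatives into derivatives
    of one variable and passes them to slices. *)
Lemma is_derive_line {R : realType} {V W : normedModType R} {f : V -> R}
    {g : W -> R} {x u : V} {y w : W} {d : R} :
  (forall r, f (r *: u + x) = g (r *: w + y)) ->
  is_derive x u f d -> is_derive y w g d.
Proof.
move=> fg [df vf].
have E : (fun h : R => h^-1 *: ((g \o shift y) (h *: w) - g y)) =
         (fun h : R => h^-1 *: ((f \o shift x) (h *: u) - f x)).
  apply/funext => r /=; rewrite !fg; congr (_ *: (_ - _)).
  by have := fg 0; rewrite !scale0r !add0r.
by split; [rewrite /derivable E|rewrite /derive E].
Qed.

Lemma integral_derive_eq0 {R : realType} (F f : R -> R) (M : R) :
  (forall x : R, is_derive x 1 F (f x)) -> continuous f ->
  (forall x, M < `|x| -> F x = 0) -> (forall x, M < `|x| -> f x = 0) ->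
  (\int[@lebesgue_measure R]_x (f x)%:E = 0)%E.
Proof.
move=> dF cf F0 f0; pose b := `|M| + 1.
have b0 : 0 < b by rewrite /b ltr_wpDl.
have Mb : M < b by rewrite /b (le_lt_trans (ler_norm M))// ltrDl.
have cF : continuous F.
  by move=> x; apply: differentiable_continuous; apply/derivable1_diffP; apply: ex_derive.
transitivity (\int[@lebesgue_measure R]_(x in `[(- b)%R, b]) (f x)%:E)%E.
  rewrite [RHS]integral_mkcond; apply: eq_integral => x _.
  rewrite patchE; case: ifPn => //.
  rewrite notin_setE /= in_itv /= -ler_norml => /negP; rewrite -ltNge => bx.
  by rewrite f0// (lt_trans Mb).
rewrite (@continuous_FTC2 _ f F)//.
- by rewrite !F0 ?subee//; rewrite ?normrN gtr0_norm.
- by rewrite ltrNl; lra.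
- exact: continuous_subspaceT.
- split.
  + by move=> x _; apply: ex_derive.
  + by apply: cvg_at_right_filter; exact: cF.
  + by apply: cvg_at_left_filter; exact: cF.
- by move=> x _; rewrite derive1E; apply: derive_val.
Qed.

(** Compact support in a form that coordinate slices inherit. *)
Definition supported_in_cube {R : realType} {n : nat} (M : R) (f : 'rV[R]_n -> R) :=
  forall (x : 'rV[R]_n) (j : 'I_n), M < `|x ord0 j| -> f x = 0.

Definition cube {R : realType} (n : nat) (M : R) : set 'rV[R]_n :=
  [set v | forall i, `[- M, M]%classic (v ord0 i)].

Lemma compact_cube {R : realType} (n : nat) (M : R) : compact (@cube R n M).
Proof.
apply: (@rV_compact R n (fun=> `[- M, M]%classic)) => i; exact: segment_compact.
Qed.

Lemma measurable_cube {R : realType} (n : nat) (M : R) : measurable (@cube R n M).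
Proof. by apply: (@measurable_box R n (fun=> `[- M, M]%classic)). Qed.

Lemma notin_cube {R : realType} {n : nat} {M : R} {x : 'rV[R]_n} :
  ~ cube n M x -> exists j, M < `|x ord0 j|.
Proof.
move=> nx; apply: contrapT => /forallNP h; apply: nx => i /=.
by rewrite in_itv /= -ler_norml leNgt; apply/negP; exact: h.
Qed.

Lemma borel_lebesgue_cube_lty {R : realType} (n : nat) (M : R) :
  (borel_lebesgue_rV n (cube n M) < +oo)%E.
Proof.
rewrite (@borel_lebesgue_rV_box R n (fun=> `[- M, M]%classic))//.
have -> : lebesgue_measure `[- M, M]%classic =
    (fine (lebesgue_measure `[- M, M]%classic) : R)%:E.
  by rewrite fineK// lebesgue_measure_itv /=; case: ifP => // _; rewrite -EFinB.
by rewrite prodEFin ltry.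
Qed.

Lemma bounded_supported {R : realType} {n : nat} {M : R} {f : 'rV[R]_n -> R} :
  continuous f -> supported_in_cube M f -> exists2 C, 0 <= C & forall x, `|f x| <= C.
Proof.
move=> cf f0.
have /compact_bounded[C [_ hC]] : compact (f @` cube n M).
  by apply: continuous_compact; [exact: continuous_subspaceT|exact: compact_cube].
exists (`|C| + 1); first by rewrite addr_ge0.
move=> x; have [bx|/notin_cube[j /f0 ->]] := pselect (cube n M x).
  apply: (hC (`|C| + 1)); last by exists x.
  by rewrite (le_lt_trans (ler_norm C))// ltrDl.
by rewrite normr0 addr_ge0.
Qed.

Lemma integrable_supported {R : realType} {n : nat} {M : R} {f : 'rV[R]_n -> R} :
  continuous f -> supported_in_cube M f ->
  (borel_lebesgue_rV n).-integrable setT (EFin \o f).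
Proof.
move=> cf f0; have [C C0 fC] := bounded_supported cf f0.
have mf : measurable_fun [set: 'rV[R]_n] (EFin \o f).
  by apply/measurable_EFinP; exact: measurable_continuous_rV.
apply/integrableP; split => //.
apply: (@le_lt_trans _ _ (\int[borel_lebesgue_rV n]_(x in cube n M) (cst C%:E x))%E).
  rewrite [leRHS]integral_mkcond; apply: ge0_le_integral => //.
  - by apply: measurableT_comp.
  - apply/(measurable_restrictT _ (measurable_cube n M)) => //.
  - move=> x _; rewrite patchE; case: ifPn => [_|].
      by rewrite /= lee_fin.
    by rewrite notin_setE => /notin_cube[j /f0 /= ->]; rewrite normr0.
rewrite integral_cst//; last exact: measurable_cube.
by rewrite lte_mul_pinfty//; exact: borel_lebesgue_cube_lty.
Qed.

Lemma rV_cons_nonexpansive {R : realType} {n : nat} (p q : R * 'rV[R]_n) (e : R) :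
  ball p e q -> ball (rV_cons p) e (rV_cons q).
Proof.
move=> [b1 [e0 b2]]; split => // i j; rewrite /rV_cons !mxE.
by case: unliftP => [k _|_]//; exact: b2.
Qed.

Lemma continuous_rV_cons_head {R : realType} {n : nat} (v : 'rV[R]_n) :
  continuous (fun x : R => rV_cons (x, v)).
Proof.
move=> x A /nbhs_ballP[e e0 eA]; apply/nbhs_ballP; exists e => //= y xy; apply: eA.
by apply: rV_cons_nonexpansive; split => //; exact: ballxx.
Qed.

Lemma continuous_rV_cons_tail {R : realType} {n : nat} (x : R) :
  continuous (fun v : 'rV[R]_n => rV_cons (x, v)).
Proof.
move=> v A /nbhs_ballP[e e0 eA]; apply/nbhs_ballP; exists e => //= w vw; apply: eA.
by apply: rV_cons_nonexpansive; split => //; exact: ballxx.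
Qed.

Lemma rV_cons_line0 {R : realType} {n : nat} (x r : R) (v : 'rV[R]_n) :
  rV_cons (r *: 1 + x, v) = r *: delta_mx ord0 ord0 + rV_cons (x, v).
Proof.
apply/rowP => j; rewrite !mxE eqxx /=.
by case: unliftP => [k|] -> /=; rewrite ?eqxx ?mulr0 ?add0r.
Qed.

Lemma rV_cons_line {R : realType} {n : nat} (x r : R) (v : 'rV[R]_n) (i : 'I_n) :
  rV_cons (x, r *: delta_mx ord0 i + v) =
  r *: delta_mx ord0 (lift ord0 i) + rV_cons (x, v).
Proof.
apply/rowP => j; rewrite !mxE eqxx /=.
case: unliftP => [k|] -> /=; first by rewrite !mxE (inj_eq lift_inj).
by rewrite mulr0 add0r.
Qed.

(** The divergence theorem without boundary term. The measure splits off the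
    first coordinate, so by induction on the dimension it is Fubini's theorem,
    with the inner integral taken over the first coordinate when that is the
    direction of differentiation (fundamental theorem of calculus), and over the
    remaining ones otherwise (induction hypothesis). *)
Lemma integral_partial_eq0 {R : realType} (n : nat) (i : 'I_n)
    (h dh : 'rV[R]_n -> R) (M : R) :
  (forall x, is_derive x (delta_mx ord0 i) h (dh x)) -> continuous dh ->
  supported_in_cube M h -> supported_in_cube M dh ->
  (\int[borel_lebesgue_rV n]_x (dh x)%:E = 0)%E.
Proof.
elim: n => [|n IHn] in i h dh *; first by case: i.
move=> dhP cdh h0 dh0.
have mdh : measurable_fun [set: 'rV[R]_n.+1] (EFin \o dh).
  by apply/measurable_EFinP; exact: measurable_continuous_rV.
pose m := borel_lebesgue_rV n : {sigma_finite_measure set 'rV[R]_n -> \bar R}.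
pose lm := (@lebesgue_measure R \x m)%E :
  {measure set (measurableTypeR R * 'rV[R]_n) -> \bar R}.
have mcons : measurable_fun [set: measurableTypeR R * 'rV[R]_n] (@rV_cons R n).
  exact: measurable_rV_cons.
have idh : lm.-integrable setT (EFin \o dh \o @rV_cons R n).
  have /integrableP[_] := integrable_supported cdh dh0.
  move=> fin; apply/integrableP; split; first exact: measurableT_comp.
  apply: le_lt_trans fin.
  rewrite [leRHS](@ge0_integral_pushforward _ _ _ _ R _ mcons
    lm setT (fun x => `|(dh x)%:E|%E))//.
  by apply: measurableT_comp.
transitivity (\int[lm]_p (dh (rV_cons p))%:E)%E.
  exact: (@integral_pushforward _ _ _ _ R _ mcons lm setT (EFin \o dh)).
case: (unliftP ord0 i) => [j|] ij.
- rewrite -(integral12_prod_meas1 idh); apply: integral0_eq => x _ /=.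
  apply: (IHn j (fun v => h (rV_cons (x, v)))).
  + move=> v; apply: is_derive_line (dhP (rV_cons (x, v))) => r.
    by rewrite rV_cons_line ij.
  + move=> v; apply: (continuous_comp (f := fun v => rV_cons (x, v)) (g := dh)).
      exact: continuous_rV_cons_tail.
    exact: cdh.
  + by move=> v k vk; apply: (h0 _ (lift ord0 k)); rewrite mxE liftK.
  + by move=> v k vk; apply: (dh0 _ (lift ord0 k)); rewrite mxE liftK.
- rewrite -(integral21_prod_meas1 idh); apply: integral0_eq => v _ /=.
  apply: (@integral_derive_eq0 R (fun x => h (rV_cons (x, v))) _ M).
  + move=> x; apply: is_derive_line (dhP (rV_cons (x, v))) => r.
    by rewrite rV_cons_line0 ij.
  + move=> x; apply: (continuous_comp (f := fun x => rV_cons (x, v)) (g := dh)).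
      exact: continuous_rV_cons_head.
    exact: cdh.
  + by move=> x xM; apply: (h0 _ ord0); rewrite mxE unlift_none.
  + by move=> x xM; apply: (dh0 _ ord0); rewrite mxE unlift_none.
Qed.

(** * Classical gradients are weak gradients *)

Lemma L1_loc_supported {R : realType} {n : nat} {M : R} {f : 'rV[R]_n -> R} :
  continuous f -> supported_in_cube M f -> L1_loc (EFin \o f).
Proof.
move=> cf f0; have mf : measurable_fun [set: 'rV[R]_n] (EFin \o f).
  by apply/measurable_EFinP; exact: measurable_continuous_rV.
split; first exact: measurable_fun_lebesgue_rV.
move=> K cK; have /integrableP[_] := integrable_supported cf f0.
apply: le_lt_trans; rewrite -integral_lebesgue_borel; last exact: measurableT_comp.
apply: ge0_subset_integral.
- by apply: measurable_lebesgue_rV; exact: compact_measurable_rV.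
- exact: measurableT.
- by apply: measurable_fun_lebesgue_rV; exact: measurableT_comp.
- by move=> x _; exact: abse_ge0.
- exact: subsetT.
Qed.

(** The product of [phi] with a test function has integrable partial derivatives
    and compact support, so these integrate to zero; Leibniz' rule is then the
    formula of integration by parts. *)
Lemma weak_gradient_C1 {R : realType} {n : nat} (M : R) (phi : 'rV[R]_n -> R)
    (g : 'rV[R]_n -> 'rV[R]_n) :
  continuous phi -> (forall i, continuous (fun x => g x ord0 i)) ->
  (forall i x, is_derive x (delta_mx ord0 i) phi (g x ord0 i)) ->
  supported_in_cube M phi -> (forall i, supported_in_cube M (fun x => g x ord0 i)) ->
  weak_gradient phi g.
Proof.
move=> cphi cg dphi phi0 g0; split; first exact: L1_loc_supported cphi phi0.
move=> i; split; first exact: L1_loc_supported (cg i) (g0 i).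
move=> psi [spsi _].
have [cpsi dpsi] := spsi [::]; have [cdpsi _] := spsi [:: i]; rewrite /= in cpsi dpsi cdpsi.
have c1 : continuous (fun x => phi x * partial_deriv i psi x).
  by move=> x; apply: continuousM; [exact: cphi|exact: cdpsi].
have c2 : continuous (fun x => g x ord0 i * psi x).
  by move=> x; apply: continuousM; [exact: cg|exact: cpsi].
have s1 : supported_in_cube M (fun x => phi x * partial_deriv i psi x).
  by move=> x j /phi0 ->; rewrite mul0r.
have s2 : supported_in_cube M (fun x => g x ord0 i * psi x).
  by move=> x j /(g0 i) ->; rewrite mul0r.
have i1 := integrable_supported c1 s1; have i2 := integrable_supported c2 s2.
have mEFin (f : 'rV[R]_n -> R) : continuous f -> measurable_fun [set: 'rV[R]_n] (EFin \o f).
  by move=> cf; apply/measurable_EFinP; exact: measurable_continuous_rV.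
have m1 := mEFin _ c1; have m2 := mEFin _ c2.
rewrite !integral_lebesgue_borel; [|exact: m2|exact: m1].
have : (\int[borel_lebesgue_rV n]_x
   ((phi x * partial_deriv i psi x) + (g x ord0 i * psi x))%:E = 0)%E.
  apply: (@integral_partial_eq0 R n i (phi * psi) _ M).
  - move=> x; have dpsix : is_derive x (delta_mx ord0 i) psi (partial_deriv i psi x).
      by split => //; exact: dpsi.
    have := is_deriveM (dphi i x) dpsix.
    by rewrite /GRing.scale /= [psi x * _]mulrC.
  - by move=> x; exact: cvgD (c1 x) (c2 x).
  - by move=> x j /phi0 h; rewrite /GRing.mul /= h mul0r.
  - by move=> x j xj; rewrite (s1 _ _ xj) (s2 _ _ xj) addr0.
under eq_integral do rewrite EFinD.
have := integralD measurableT i1 i2; rewrite /= => ->.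
rewrite -(fineK (integrable_fin_num measurableT i1)).
rewrite -(fineK (integrable_fin_num measurableT i2)) -EFinD -EFinN.
by move=> [/eqP]; rewrite addr_eq0 => /eqP ->.
Qed.

(** * A radial profile with quadratic cut-off *)

Definition hinge {R : realType} (s : R) : R := Num.max 0 (1 - s).

Lemma hinge_ge0 {R : realType} (s : R) : 0 <= hinge s.
Proof. by rewrite /hinge le_max lexx. Qed.

Lemma hinge_eq0 {R : realType} (s : R) : 1 <= s -> hinge s = 0.
Proof. by move=> s1; rewrite /hinge; apply/max_idPl; lra. Qed.

Lemma hinge_subr {R : realType} (s : R) : s <= 1 -> hinge s = 1 - s.
Proof. by move=> s1; rewrite /hinge; apply/max_idPr; lra. Qed.

Lemma continuous_hinge {R : realType} : continuous (@hinge R).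
Proof.
move=> s; apply: (@continuous_max R R (cst 0) (fun s => 1 - s)); first exact: cvg_cst.
by apply: cvgB; [exact: cvg_cst|exact: cvg_id].
Qed.

(** Squaring removes the corner at [s = 1]: the second-order Taylor remainder is
    bounded by [h^2] on both sides of it. This is why the cut-off of the profile
    is a square, which makes the trial functions of class C^1. *)
Lemma is_derive_hinge_sqr {R : realType} (s : R) :
  is_derive s 1 (fun s => hinge s ^+ 2) (- (2 * hinge s)).
Proof.
have E (h : R) : `|hinge (h + s) ^+ 2 - hinge s ^+ 2 + 2 * hinge s * h| <= h ^+ 2.
  rewrite ler_norml.
  have [sh|/ltW sh] := leP (h + s) 1; have [s1|/ltW s1] := leP s 1;
    rewrite ?(hinge_subr _ sh) ?(hinge_subr _ s1) ?(hinge_eq0 _ sh) ?(hinge_eq0 _ s1).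
  - by apply/andP; split; nra.
  - by apply/andP; split; nra.
  - by apply/andP; split; nra.
  - by apply/andP; split; nra.
pose f (s : R) := hinge s ^+ 2.
have C : h^-1 *: ((f \o shift s) (h *: 1) - f s) @[h --> 0^'] --> - (2 * hinge s).
  apply/cvgrPdist_le => e e0; near=> h.
  have h0 : h != 0 by near: h; exact: nbhs_dnbhs_neq.
  have he : `|h| <= e by near: h; apply: dnbhs0_le.
  apply: le_trans he; rewrite /= /f /GRing.scale /= mulr1.
  have := E h; set a := _ ^+ 2 - _ => Ea.
  rewrite -normrN opprB opprK (_ : _ + _ = (a + 2 * hinge s * h) / h); last by field.
  by rewrite normrM normfV ler_pdivrMr ?normr_gt0// -normrM -expr2 (ger0_norm (sqr_ge0 h)).
by split; [exact: cvgP C|exact: cvg_lim C].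
Unshelve. all: by end_near.
Qed.

Lemma dotv_line {R : realType} {n : nat} (x : 'rV[R]_n) (i : 'I_n) (r : R) :
  dotv (r *: delta_mx ord0 i + x) (r *: delta_mx ord0 i + x) =
  r ^+ 2 + r * (2 * x ord0 i) + dotv x x.
Proof.
rewrite /dotv (bigD1 i)//= [in RHS](bigD1 i)//= !mxE !eqxx /=.
rewrite (eq_bigr (fun j => x ord0 j * x ord0 j)); last first.
  by move=> j ji; rewrite !mxE eqxx (negbTE ji) /= mulr0 add0r.
ring.
Qed.

(** Along the line in direction [i] the squared norm is a quadratic polynomial,
    so the chain rule in one variable suffices. *)
Lemma is_derive_radial {R : realType} {n : nat} (F : R -> R) (d : R)
    (x : 'rV[R]_n) (i : 'I_n) :
  is_derive (dotv x x) 1 F d ->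
  is_derive x (delta_mx ord0 i) (fun x => F (dotv x x)) (2 * d * x ord0 i).
Proof.
move=> dF.
pose q (r : R) := r ^+ 2 + r * (2 * x ord0 i) + dotv x x.
apply: (@is_derive_line R R _ (F \o q) _ 0 1) => [r|].
  by rewrite /= addr0 /GRing.scale /= mulr1 /q -dotv_line.
have q0 : q 0 = dotv x x by rewrite /q expr0n /= mul0r !add0r.
rewrite (_ : 2 * d * x ord0 i = d * (2 * x ord0 i)); last by ring.
apply: is_derive1_comp; first by rewrite q0.
rewrite /q; apply: is_derive_eq.
by rewrite /GRing.scale /= ; ring.
Qed.

Lemma continuous_dotv {R : realType} {n : nat} :
  continuous (fun x : 'rV[R]_n => dotv x x).
Proof.
rewrite /dotv; elim: (index_enum _) => [|i s IHs].
  by under eq_fun do rewrite big_nil; move=> x; exact: cst_continuous.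
under eq_fun do rewrite big_cons.
have ci := @coord_continuous R 1 n ord0 i.
move=> x; apply: (@continuousD R R 'rV[R]_n (fun x => x ord0 i * x ord0 i)); last exact: IHs.
by apply: (@continuousM R 'rV[R]_n (fun x => x ord0 i) (fun x => x ord0 i) x); exact: ci.
Qed.

Lemma dotv_ge0 {R : realType} {n : nat} (x : 'rV[R]_n) : 0 <= dotv x x.
Proof. by apply: sumr_ge0 => i _; rewrite -expr2 sqr_ge0. Qed.

Lemma dotv_coord {R : realType} {n : nat} (x : 'rV[R]_n) j : x ord0 j ^+ 2 <= dotv x x.
Proof.
rewrite /dotv (bigD1 j)//= -expr2 lerDl.
by apply: sumr_ge0 => i _; rewrite -expr2 sqr_ge0.
Qed.

Lemma enorm_sqr {R : realType} {n : nat} (x : 'rV[R]_n) : enorm x ^+ 2 = dotv x x.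
Proof. by rewrite /enorm sqr_sqrtr// dotv_ge0. Qed.

(** The profile is a function of [s = |x|^2], so that the first factor
    regularizes [|x|^-t] at the origin. *)
Section profile.
Context {R : realType} (t eps : R).

Definition profile (s : R) : R := (eps + s) `^ (- (t / 2)) * hinge s ^+ 2.

Definition dprofile (s : R) : R :=
  - (t / 2) * (eps + s) `^ (- (t / 2) - 1) * hinge s ^+ 2 -
  2 * (eps + s) `^ (- (t / 2)) * hinge s.

Let continuous_powRD (p s : R) : 0 < eps + s ->
  {for s, continuous (fun s => (eps + s) `^ p)}.
Proof.
move=> es; apply: (continuous_comp (f := fun s => eps + s) (g := fun y => y `^ p)).
  by apply: cvgD; [exact: cvg_cst|exact: cvg_id].
apply: differentiable_continuous; apply/derivable1_diffP; apply: ex_derive.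
exact: is_derive1_powR.
Qed.

Lemma is_derive_profile (s : R) : 0 < eps + s -> is_derive s 1 profile (dprofile s).
Proof.
move=> es.
have d1 : is_derive s 1 (fun s : R => eps + s) 1.
  by have := is_deriveD (is_derive_cst eps s 1) (is_derive_id s (1 : R)); rewrite add0r.
have d2 := is_derive1_comp (is_derive1_powR (- (t / 2)) es) d1.
have := is_deriveM d2 (is_derive_hinge_sqr s).
rewrite /profile /dprofile /GRing.scale /= => d3.
apply: is_derive_eq d3 _.
ring.
Qed.

Lemma continuous_profile (s : R) : 0 < eps + s -> {for s, continuous profile}.
Proof.
move=> es; apply: differentiable_continuous; apply/derivable1_diffP; apply: ex_derive.
exact: is_derive_profile.
Qed.

Lemma continuous_dprofile (s : R) : 0 < eps + s -> {for s, continuous dprofile}.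
Proof.
move=> es; have ch := @continuous_hinge R s.
apply: cvgB; apply: cvgM.
- apply: cvgM; [exact: cvg_cst|exact: continuous_powRD].
- by apply: cvgM.
- apply: cvgM; [exact: cvg_cst|exact: continuous_powRD].
- exact: ch.
Qed.

End profile.

(** * Pointwise bounds on the trial functions *)

Lemma ler_powRN {R : realType} (t x y : R) : 0 <= t -> 0 < x -> x <= y ->
  y `^ (- t) <= x `^ (- t).
Proof.
move=> t0 x0 xy; rewrite !powRN lef_pV2 ?posrE ?powR_gt0//; last exact: lt_le_trans xy.
by apply: ge0_ler_powR => //; rewrite nnegrE ltW// (lt_le_trans x0).
Qed.

Lemma enorm_powR {R : realType} {n : nat} (x : 'rV[R]_n) (p : R) :
  enorm x `^ (2 * p) = dotv x x `^ p.
Proof.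
by rewrite /enorm -powR12_sqrt ?dotv_ge0// -powRrM mulrA mulVf// mul1r.
Qed.

Section profile_bounds.
Context {R : realType} (t eps s : R).
Hypotheses (t0 : 0 < t) (eps0 : 0 < eps) (s0 : 0 < s).

Let es0 : 0 < eps + s. Proof. exact: addr_gt0. Qed.

Lemma profile_sqrE : profile t eps s ^+ 2 = (eps + s) `^ (- t) * hinge s ^+ 4.
Proof.
rewrite /profile exprMn -exprM -[X in X * _]powR_mulrn ?powR_ge0// -powRrM.
by rewrite mulNr mulfVK.
Qed.

(** The integrable majorant [|x|^(-2t)] on the unit ball, in terms of
    [s = |x|^2]; it does not depend on [eps]. *)
Definition cut_weight : R := if s <= 1 then s `^ (- t) else 0.

Lemma profile_sqr_le : profile t eps s ^+ 2 <= cut_weight.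
Proof.
rewrite profile_sqrE /cut_weight; case: ifPn => [s1|]; last first.
  by rewrite -ltNge => /ltW s1; rewrite hinge_eq0// expr0n mulr0.
rewrite -[leRHS]mulr1; apply: ler_pM; rewrite ?powR_ge0 ?exprn_ge0 ?hinge_ge0//.
  by apply: ler_powRN; rewrite ?(ltW t0)// lerDr ltW.
by rewrite exprn_ile1 ?hinge_ge0// hinge_subr// lerBlDr lerDl ltW.
Qed.

(** The left-hand side is the squared gradient of the trial function. Where only
    the power is differentiated one gets at most the Hardy potential with the
    critical constant [t^2], because [s/(eps + s)^2 <= 1/s]; every term that
    contains the derivative of the cut-off is at most a constant times the
    integrable majorant, uniformly in [eps]. *)
Lemma dprofile_sqr_le : 4 * s * dprofile t eps s ^+ 2 <=
  t ^+ 2 * (profile t eps s ^+ 2 / s) + (8 * t + 16) * cut_weight.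
Proof.
have [s1|s1] := leP s 1; last first.
  rewrite /dprofile /profile /cut_weight [s <= 1]leNgt s1 /= hinge_eq0 ?(ltW s1)//.
  by rewrite !expr0n /= !(mulr0, subrr, mul0r, addr0, expr0n).
have a2 := @ler_powRN R t s (eps + s) (ltW t0) s0; rewrite lerDr (ltW eps0) in a2.
have := a2 isT.
have -> : (eps + s) `^ (- t) = ((eps + s) `^ (- (t / 2))) ^+ 2.
  by rewrite -[RHS]powR_mulrn ?powR_ge0// -powRrM mulNr mulfVK.
rewrite /cut_weight s1 /dprofile /profile.
rewrite powRB ?(gt_eqF es0) ?implybT// powRr1 ?(ltW es0)// hinge_subr//.
set a := _ `^ (- (t / 2)); set b := s `^ _; move=> ab.
set m := 1 - s; set w := (eps + s)^-1.
have w0 : 0 < w by rewrite invr_gt0.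
have sw : s * w <= 1 by rewrite ler_pdivrMr// mul1r lerDr ltW.
have m0 : 0 <= m by rewrite subr_ge0.
have m1 : m <= 1 by rewrite lerBlDr lerDl ltW.
(* The square expanded, with w = 1/(eps + s) and m = 1 - s. *)
have -> : 4 * s * (- (t / 2) * (a * w) * m ^+ 2 - 2 * a * m) ^+ 2 =
   t ^+ 2 * (a ^+ 2 * m ^+ 4 * (s * w ^+ 2)) + 8 * t * (a ^+ 2 * (m ^+ 3 * (s * w))) +
   16 * (a ^+ 2 * (m ^+ 2 * s)) by field.
have a0 : 0 <= a ^+ 2 by exact: sqr_ge0.
have h1 : s * w ^+ 2 <= s^-1.
  rewrite -[leRHS]mul1r ler_pdivlMr// (_ : _ * s = (s * w) ^+ 2); last by ring.
  by rewrite exprn_ile1 ?mulr_ge0 ?(ltW s0) ?(ltW w0).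
have h2 : m ^+ 3 * (s * w) <= 1.
  by rewrite mulr_ile1 ?exprn_ge0 ?exprn_ile1 ?mulr_ge0 ?(ltW s0) ?(ltW w0).
have h3 : m ^+ 2 * s <= 1.
  by rewrite mulr_ile1 ?exprn_ge0 ?exprn_ile1 ?(ltW s0).
rewrite (mulrDl (8 * t)) -[leLHS]addrA; apply: lerD.
  rewrite exprMn -exprM; apply: ler_wpM2l; first exact: sqr_ge0.
  by apply: ler_wpM2l h1; apply: mulr_ge0 => //; exact: exprn_ge0.
apply: lerD; apply: ler_wpM2l; rewrite ?mulr_ge0 ?(ltW t0)//.
  by apply: le_trans ab; rewrite ler_piMr.
by apply: le_trans ab; rewrite ler_piMr.
Qed.

End profile_bounds.

(** * The trial functions belong to the weighted Sobolev space *)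

Lemma dotv_gt0 {R : realType} {n : nat} (x : 'rV[R]_n) : x != 0 -> 0 < dotv x x.
Proof.
move=> x0; have [j xj] : exists j, x ord0 j != 0.
  apply/existsP; apply: contraNT x0; rewrite negb_exists => /forallP h.
  by apply/eqP/rowP => j; rewrite mxE; apply/eqP; rewrite -[_ == _]negbK.
by apply: lt_le_trans (dotv_coord x j); rewrite exprn_even_gt0.
Qed.

Lemma dotv0 {R : realType} {n : nat} : dotv (0 : 'rV[R]_n) 0 = 0.
Proof. by rewrite /dotv big1// => i _; rewrite !mxE mul0r. Qed.

Lemma dotvZ {R : realType} {n : nat} (a : R) (x : 'rV[R]_n) :
  dotv (a *: x) (a *: x) = a ^+ 2 * dotv x x.
Proof. by rewrite /dotv mulr_sumr; apply: eq_bigr => i _; rewrite !mxE; ring. Qed.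

(** Quotients by [|x|] and negative powers of it take a junk value at the origin,
    which is a null set in positive dimension. *)
Lemma ae_neq0 {R : realType} {n : nat} (P : 'rV[R]_n -> Prop) : (1 <= n)%N ->
  (forall x, x != 0 -> P x) -> {ae @lebesgue_rV R n, forall x : 'rV[R]_n, P x}.
Proof.
move=> n1 Pneq0; exists [set x : 'rV[R]_n | forall i, [set (0 : R)] (x ord0 i)]; split.
- apply: measurable_lebesgue_rV.
  exact: (@measurable_box R n (fun=> [set (0 : R)])).
- case: n P n1 Pneq0 => // n _ _ _.
  rewrite (@lebesgue_rV_box R n.+1 (fun=> [set (0 : R)]))//.
  by rewrite big_ord_recl lebesgue_measure_set1 mul0e.
- move=> x /= nPx i; apply: contrapT => xi0; apply: nPx; apply: Pneq0.
  by apply/eqP => x0; apply: xi0; rewrite x0 mxE.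
Qed.

Lemma measurable_dotv {R : realType} {n : nat} :
  measurable_fun [set: 'rV[R]_n] (fun x => dotv x x).
Proof. exact: measurable_continuous_rV continuous_dotv. Qed.

Lemma measurable_dotv_powR {R : realType} {n : nat} (p : R) :
  measurable_fun [set: 'rV[R]_n] (fun x => dotv x x `^ p).
Proof. exact: measurableT_comp (measurable_powR p) measurable_dotv. Qed.

Section weighted.
Context {R : realType} {n : nat} (mu : 'rV[R]_n -> R).
Hypotheses (mu_ge0 : forall x, 0 <= mu x) (mu_L1 : L1_loc (EFin \o mu)).

Lemma measurable_weighted (f : 'rV[R]_n -> R) : measurable_fun [set: 'rV[R]_n] f ->
  measurable_fun [set: lebesgue_rV_type R n] (fun x => (f x * mu x)%:E).
Proof.
move=> mf; apply/measurable_EFinP; apply: measurable_funM.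
  exact: measurable_fun_lebesgue_rV.
by apply/measurable_EFinP; exact: mu_L1.1.
Qed.

(** Continuous functions of compact support are bounded, and [mu] is locally
    integrable. *)
Lemma weighted_supported_lty (M : R) (f : 'rV[R]_n -> R) :
  (forall x, 0 <= f x) -> continuous f -> supported_in_cube M f ->
  (\int[@lebesgue_rV R n]_x (f x * mu x)%:E < +oo)%E.
Proof.
move=> f0 cf sf; have [C C0 fC] := bounded_supported cf sf.
have mcube := measurable_lebesgue_rV _ (measurable_cube n M).
have mabs : measurable_fun [set: lebesgue_rV_type R n] (fun x => `|(mu x)%:E|%E).
  by apply: measurableT_comp; [exact: abse_measurable|exact: mu_L1.1].
have mabs_cube : measurable_fun (cube n M : set (lebesgue_rV_type R n))
    (fun x : lebesgue_rV_type R n => `|(mu x)%:E|%E) by exact: measurable_funTS.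
apply: (@le_lt_trans _ _
    (\int[@lebesgue_rV R n]_(x in cube n M) (C%:E * `|(mu x)%:E|))%E).
  rewrite [leRHS]integral_mkcond; apply: ge0_le_integral.
  - exact: measurableT.
  - by move=> x _; rewrite lee_fin mulr_ge0.
  - by apply: measurable_weighted; exact: measurable_continuous_rV.
  - apply/(measurable_restrictT _ mcube); exact: measurable_funeM.
  - move=> x _; rewrite patchE; case: ifPn => [_|].
      rewrite -EFinM lee_fin ger0_norm// ler_wpM2r//.
      by rewrite (le_trans _ (fC x))// ler_norm.
    by rewrite notin_setE => /notin_cube[j /sf ->]; rewrite mul0r.
rewrite ge0_integralZl_EFin;
  [|exact: mcube|by move=> x _; exact: abse_ge0|exact: mabs_cube|exact: C0].
by rewrite lte_mul_pinfty//; exact: (mu_L1.2 _ (compact_cube n M)).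
Qed.

Lemma L2_weighted_supported (M : R) (f : 'rV[R]_n -> R) :
  continuous f -> supported_in_cube M f -> L2_weighted mu f.
Proof.
move=> cf sf; split.
  by apply: measurable_fun_lebesgue_rV; exact: measurable_continuous_rV.
apply: (@weighted_supported_lty M) => [x||x j /sf ->]; last by rewrite expr0n.
- exact: sqr_ge0.
- by move=> x; apply: (@continuousM R 'rV[R]_n f f x); exact: cf.
Qed.

End weighted.

Section trial.
Context {R : realType} {n : nat} (t eps : R).
Hypothesis eps0 : 0 < eps.

Definition trial (x : 'rV[R]_n) : R := profile t eps (dotv x x).

Definition dtrial (x : 'rV[R]_n) : 'rV[R]_n := (2 * dprofile t eps (dotv x x)) *: x.

Let es0 (x : 'rV[R]_n) : 0 < eps + dotv x x.
Proof. by rewrite ltr_pwDl// dotv_ge0. Qed.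

Let dotv_out (x : 'rV[R]_n) j : 1 < `|x ord0 j| -> 1 <= dotv x x.
Proof.
move=> xj; apply: le_trans (dotv_coord x j).
by rewrite -real_normK ?num_real// exprn_ege1// ltW.
Qed.

Lemma continuous_trial : continuous trial.
Proof.
move=> x; apply: (@continuous_comp _ _ _ (fun x => dotv x x) (profile t eps)).
  exact: continuous_dotv.
exact: continuous_profile.
Qed.

Let continuous_dprofile_dotv : continuous (fun x : 'rV[R]_n => dprofile t eps (dotv x x)).
Proof.
move=> x; apply: (@continuous_comp _ _ _ (fun x => dotv x x) (dprofile t eps)).
  exact: continuous_dotv.
exact: continuous_dprofile.
Qed.

Lemma continuous_dtrial i : continuous (fun x => dtrial x ord0 i).
Proof.
rewrite /dtrial; under eq_fun do rewrite mxE.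
move=> x; apply: (@continuousM R 'rV[R]_n (fun x => 2 * dprofile t eps (dotv x x))
   (fun x => x ord0 i)).
  apply: (@continuousM R 'rV[R]_n (fun x => 2) (fun x => dprofile t eps (dotv x x))).
    exact: cst_continuous.
  exact: continuous_dprofile_dotv.
exact: coord_continuous.
Qed.

Lemma trial_supported : supported_in_cube 1 trial.
Proof.
by move=> x j /dotv_out s1; rewrite /trial /profile hinge_eq0// expr0n mulr0.
Qed.

Let dprofile_eq0 (x : 'rV[R]_n) j : 1 < `|x ord0 j| -> dprofile t eps (dotv x x) = 0.
Proof.
by move=> /dotv_out s1; rewrite /dprofile hinge_eq0// expr0n !mulr0 subrr.
Qed.

Lemma dtrial_supported i : supported_in_cube 1 (fun x => dtrial x ord0 i).
Proof. by move=> x j /dprofile_eq0 h; rewrite /dtrial mxE h mulr0 mul0r. Qed.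

Lemma weak_gradient_trial : weak_gradient trial dtrial.
Proof.
apply: (@weak_gradient_C1 R n 1).
- exact: continuous_trial.
- exact: continuous_dtrial.
- move=> i x; rewrite /dtrial mxE; apply: is_derive_radial.
  exact: is_derive_profile.
- exact: trial_supported.
- exact: dtrial_supported.
Qed.

Lemma enorm_dtrial_sqr x :
  enorm (dtrial x) ^+ 2 = 4 * dotv x x * dprofile t eps (dotv x x) ^+ 2.
Proof. by rewrite enorm_sqr dotvZ; ring. Qed.

Context {mu : 'rV[R]_n -> R}.
Hypotheses (mu_ge0 : forall x, 0 <= mu x) (mu_L1 : L1_loc (EFin \o mu)).

Lemma H1_weighted_trial : H1_weighted mu trial.
Proof.
split; first exact: L2_weighted_supported continuous_trial trial_supported.
exists dtrial; split; first exact: weak_gradient_trial.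
move=> i; exact: L2_weighted_supported (continuous_dtrial i) (dtrial_supported i).
Qed.

Let continuous_energy : continuous (fun x : 'rV[R]_n => enorm (dtrial x) ^+ 2).
Proof.
under eq_fun do rewrite enorm_dtrial_sqr.
move=> x; apply: (@continuousM R 'rV[R]_n (fun x => 4 * dotv x x)
   (fun x => dprofile t eps (dotv x x) ^+ 2)).
  apply: (@continuousM R 'rV[R]_n (fun x => 4) (fun x => dotv x x)).
    exact: cst_continuous.
  exact: continuous_dotv.
apply: (@continuousM R 'rV[R]_n (fun x => dprofile t eps (dotv x x))
   (fun x => dprofile t eps (dotv x x))); exact: continuous_dprofile_dotv.
Qed.

Lemma trial_energy_lty :
  (\int[@lebesgue_rV R n]_x (enorm (dtrial x) ^+ 2 * mu x)%:E < +oo)%E.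
Proof.
apply: (@weighted_supported_lty _ _ _ _ _ 1) => // [|x j /dprofile_eq0 h].
- by move=> x; exact: sqr_ge0.
- by rewrite enorm_dtrial_sqr h expr0n mulr0.
Qed.

Lemma measurable_trial : measurable_fun [set: 'rV[R]_n] trial.
Proof. exact: measurable_continuous_rV continuous_trial. Qed.

Lemma measurable_energy : measurable_fun [set: 'rV[R]_n] (fun x => enorm (dtrial x) ^+ 2).
Proof. exact: measurable_continuous_rV continuous_energy. Qed.

End trial.

(** * What the inequality would imply for the trial functions *)

Lemma measurable_cut_weight {R : realType} {n : nat} (t : R) :
  measurable_fun [set: 'rV[R]_n] (fun x => cut_weight t (dotv x x)).
Proof.
rewrite /cut_weight; apply: measurable_fun_ifT.
- apply: measurable_fun_ler; first exact: measurable_dotv.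
  exact: measurable_cst.
- exact: measurable_dotv_powR.
- exact: measurable_cst.
Qed.

Lemma cut_weight_ge0 {R : realType} (t s : R) : 0 <= cut_weight t s.
Proof. by rewrite /cut_weight; case: ifP => // _; exact: powR_ge0. Qed.

(** Write [A], [G], [L] for the three integrals of the inequality and [M] for the
    integral of the majorant. The pointwise bounds give [G <= t^2 A + (8t + 16) M]
    and [L <= M], so the inequality [c A <= G + k1 L] leaves
    [(c - t^2) A <= (8t + 16 + |k1|) M], a bound on [A] that is uniform in
    [eps]. Cancelling [t^2 A] needs [A] finite; this comes from the inequality
    itself, as [G] and [L] are finite. *)
Lemma hardy_trial_bound {R : realType} {n : nat} {mu : 'rV[R]_n -> R} (c k1 t eps : R) :
  (1 <= n)%N -> (forall x, 0 <= mu x) -> L1_loc (EFin \o mu) ->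
  0 < t -> 0 < eps -> t ^+ 2 < c ->
  (\int[@lebesgue_rV R n]_x (cut_weight t (dotv x x) * mu x)%:E < +oo)%E ->
  hardy_inequality mu c k1 (trial t eps) (dtrial t eps) ->
  (\int[@lebesgue_rV R n]_x (trial t eps x ^+ 2 / enorm x ^+ 2 * mu x)%:E <=
   ((8 * t + 16 + `|k1|) *
    fine (\int[@lebesgue_rV R n]_x (cut_weight t (dotv x x) * mu x)%:E) /
    (c - t ^+ 2))%:E)%E.
Proof.
move=> n1 mu0 muL1 t0 eps0 tc.
have mW f := @measurable_weighted R n mu muL1 f.
have mcut : measurable_fun [set: 'rV[R]_n] (fun x => cut_weight t (dotv x x)).
  exact: measurable_cut_weight.
have mtr2 : measurable_fun [set: 'rV[R]_n] (fun x => trial t eps x ^+ 2).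
  by apply: measurable_funX; exact: measurable_trial.
have mpot : measurable_fun [set: 'rV[R]_n] (fun x => trial t eps x ^+ 2 / enorm x ^+ 2).
  under eq_fun do rewrite enorm_sqr -(powR_inv1 (dotv_ge0 _)).
  by apply: measurable_funM => //; exact: measurable_dotv_powR.
have men : measurable_fun [set: 'rV[R]_n] (fun x => enorm (dtrial t eps x) ^+ 2).
  exact: measurable_energy.
have pot0 x : 0 <= trial t eps x ^+ 2 / enorm x ^+ 2 by rewrite divr_ge0 ?sqr_ge0.
have LM : (\int[@lebesgue_rV R n]_x (trial t eps x ^+ 2 * mu x)%:E <=
    \int[@lebesgue_rV R n]_x (cut_weight t (dotv x x) * mu x)%:E)%E.
  apply: ae_ge0_le_integral; first exact: measurableT.
  - by move=> x _; rewrite lee_fin mulr_ge0 ?sqr_ge0.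
  - exact: mW.
  - by move=> x _; rewrite lee_fin mulr_ge0 ?cut_weight_ge0.
  - exact: mW.
  - apply: ae_neq0 => // x x0 _.
    by rewrite lee_fin ler_wpM2r// profile_sqr_le// dotv_gt0.
have GA : (\int[@lebesgue_rV R n]_x (enorm (dtrial t eps x) ^+ 2 * mu x)%:E <=
    (t ^+ 2)%:E * \int[@lebesgue_rV R n]_x (trial t eps x ^+ 2 / enorm x ^+ 2 * mu x)%:E +
    (8 * t + 16)%:E * \int[@lebesgue_rV R n]_x (cut_weight t (dotv x x) * mu x)%:E)%E.
  have C0 : 0 <= 8 * t + 16 by rewrite addr_ge0 ?mulr_ge0 ?ltW.
  have mpot' := mW _ mpot; have mcut' := mW _ mcut.
  have pot' x : (0 <= (trial t eps x ^+ 2 / enorm x ^+ 2 * mu x)%:E)%E.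
    by rewrite lee_fin mulr_ge0.
  have cut' x : (0 <= (cut_weight t (dotv x x) * mu x)%:E)%E.
    by rewrite lee_fin mulr_ge0 ?cut_weight_ge0.
  rewrite -ge0_integralZl_EFin; [|exact: measurableT|by []|exact: mpot'|exact: sqr_ge0].
  rewrite -ge0_integralZl_EFin; [|exact: measurableT|by []|exact: mcut'|exact: C0].
  rewrite -ge0_integralD; first last.
  - exact: measurable_funeM.
  - by move=> x _; rewrite mule_ge0.
  - exact: measurable_funeM.
  - by move=> x _; rewrite mule_ge0// lee_fin sqr_ge0.
  - exact: measurableT.
  apply: ae_ge0_le_integral; first exact: measurableT.
  - by move=> x _; rewrite lee_fin mulr_ge0 ?sqr_ge0.
  - exact: mW.
  - by move=> x _; rewrite adde_ge0// mule_ge0// lee_fin sqr_ge0.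
  - by apply: emeasurable_funD; exact: measurable_funeM.
  - apply: ae_neq0 => // x x0 _.
    rewrite -!EFinM -EFinD lee_fin enorm_dtrial_sqr enorm_sqr /trial.
    have := dprofile_sqr_le t eps _ t0 eps0 (dotv_gt0 x x0).
    set p := _ / dotv x x; move=> h.
    by rewrite !(mulrA _ _ (mu x)) -mulrDl ler_wpM2r.
have Gfin := @trial_energy_lty R n t eps eps0 mu mu0 muL1.
move: Gfin LM GA; rewrite /hardy_inequality.
set A := (\int[_]_x (_ / _ * _)%:E)%E; set G := (\int[_]_x (enorm _ ^+ 2 * _)%:E)%E.
set L := (\int[_]_x (trial _ _ _ ^+ 2 * _)%:E)%E.
set M := (\int[_]_x (cut_weight _ _ * _)%:E)%E.
move=> Goo LM GA Moo H.
have A0 : (0 <= A)%E by apply: integral_ge0 => x _; rewrite lee_fin mulr_ge0.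
have G0 : (0 <= G)%E by apply: integral_ge0 => x _; rewrite lee_fin mulr_ge0 ?sqr_ge0.
have L0 : (0 <= L)%E by apply: integral_ge0 => x _; rewrite lee_fin mulr_ge0 ?sqr_ge0.
have M0 : (0 <= M)%E by apply: integral_ge0 => x _; rewrite lee_fin mulr_ge0 ?cut_weight_ge0.
have c0 : 0 < c by rewrite (le_lt_trans (sqr_ge0 t)).
move: (le_lt_trans LM Moo) => Loo.
move: A G L M A0 G0 L0 M0 Goo LM GA Moo H Loo.
case=> [a| |]//; case=> [g| |]//; case=> [l| |]//; case=> [m| |]// A0 G0 L0 M0 _ LM GA _ H _;
  last by move: H; rewrite gt0_muley ?lte_fin// -EFinM -EFinD leye_eq.
move: A0 G0 L0 M0 LM GA H; rewrite -!EFinM -!EFinD !lee_fin /= => A0 G0 L0 M0 LM GA H.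
rewrite ler_pdivlMr ?subr_gt0//.
have kl : k1 * l <= `|k1| * m.
  apply: (@le_trans _ _ (`|k1| * l)); first by rewrite ler_wpM2r// ler_norm.
  by rewrite ler_wpM2l.
by lra.
Qed.

(** * The singular weight near the origin *)

Definition sqnorm_ball {R : realType} (n : nat) (r : R) : set 'rV[R]_n :=
  [set x | dotv x x <= r].

Lemma measurable_sqnorm_ball {R : realType} {n : nat} (r : R) :
  measurable (sqnorm_ball n r).
Proof.
rewrite /sqnorm_ball.
rewrite (_ : mkset _ = (fun x : 'rV[R]_n => dotv x x) @^-1` `]-oo, r]%classic); last first.
  by apply/seteqP; split => x /=; rewrite in_itv.
by rewrite -[X in measurable X]setTI; exact: measurable_dotv.
Qed.

(** As [eps] decreases to 0 the potential terms increase to the weight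
    [|x|^(-2(t + 1))] near the origin, so monotone convergence carries the
    uniform bound to the limit. *)
Lemma singular_weight_le {R : realType} {n : nat} {mu : 'rV[R]_n -> R} (t B : R) :
  (forall x, 0 <= mu x) -> L1_loc (EFin \o mu) -> 0 < t ->
  (forall k : nat, \int[@lebesgue_rV R n]_x
    (trial t k.+1%:R^-1 x ^+ 2 / enorm x ^+ 2 * mu x)%:E <= B%:E)%E ->
  (\int[@lebesgue_rV R n]_(x in sqnorm_ball n (2^-1)%R)
    (dotv x x `^ (- (t + 1)) * mu x)%:E <= (16 * B)%:E)%E.
Proof.
move=> mu0 muL1 t0 hB.
set D := sqnorm_ball n _.
have mD : @measurable _ (lebesgue_rV_type R n) D.
  by apply: measurable_lebesgue_rV; exact: measurable_sqnorm_ball.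
(* The cut-off is dropped: it is at least 1/4 on the ball, which costs the
   factor 16 once it is squared. *)
pose w (k : nat) (x : 'rV[R]_n) := (k.+1%:R^-1 + dotv x x) `^ (- t) * dotv x x `^ (- 1).
pose g k (x : lebesgue_rV_type R n) := (w k x * mu x)%:E.
have w0 k x : 0 <= w k x by rewrite mulr_ge0 ?powR_ge0.
have mw k : measurable_fun [set: 'rV[R]_n] (w k).
  apply: measurable_funM; last exact: measurable_dotv_powR.
  apply: (measurableT_comp (measurable_powR (- t))).
  by apply: measurable_funD; [exact: measurable_cst|exact: measurable_dotv].
have mgT k : measurable_fun [set: lebesgue_rV_type R n] (g k).
  exact: (measurable_weighted mu muL1 (w k) (mw k)).
have mg k : measurable_fun (D : set (lebesgue_rV_type R n)) (g k).
  exact: measurable_funTS.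
have g0 k x : D x -> (0 <= g k x)%E by move=> _; rewrite lee_fin mulr_ge0.
have ndg x : D x -> nondecreasing_seq (g ^~ x).
  move=> _ k l kl; rewrite lee_fin ler_wpM2r//; apply: ler_wpM2r; first exact: powR_ge0.
  apply: ler_powRN; first exact: ltW.
    by rewrite ltr_pwDl ?invr_gt0// dotv_ge0.
  by rewrite lerD2r lef_pV2 ?posrE// ler_nat.
have cg x : (limn (g ^~ x) = (dotv x x `^ (- (t + 1)) * mu x)%:E)%E.
  apply/cvg_lim => //; apply: cvg_EFin; first exact: nearW.
  apply: cvgM; last exact: cvg_cst.
  rewrite /w.
  (* At the origin all terms are 0 because negative powers of 0 are 0. *)
  have [->|x0] := eqVneq x 0.
    rewrite dotv0 !(powR0 (x := - 1)) ?oppr_eq0// powR0; last first.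
      by rewrite oppr_eq0 gt_eqF// addr_gt0.
    under eq_fun do rewrite mulr0.
    exact: cvg_cst.
  have s0 := dotv_gt0 x x0.
  have c1 : k.+1%:R^-1 + dotv x x @[k --> \oo] --> dotv x x.
    by rewrite -[X in _ --> X]add0r; apply: cvgD; [exact: cvg_harmonic|exact: cvg_cst].
  have c2 : {for dotv x x, continuous (fun y : R => y `^ (- t))}.
    apply: differentiable_continuous; apply/derivable1_diffP; apply: ex_derive.
    exact: is_derive1_powR.
  rewrite opprD powRD ?(gt_eqF s0) ?implybT//; apply: cvgM; last exact: cvg_cst.
  exact: (cvg_comp _ _ c1 c2).
have C := @cvg_monotone_convergence _ _ R (@lebesgue_rV R n) _ mD g mg g0 ndg.
under eq_integral do rewrite -cg.
rewrite -(cvg_lim _ C)//; apply: lime_le; first exact: (cvgP _ C).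
apply: nearW => k.
have mpot : measurable_fun [set: 'rV[R]_n]
    (fun x => trial t k.+1%:R^-1 x ^+ 2 / enorm x ^+ 2).
  under eq_fun do rewrite enorm_sqr -(powR_inv1 (dotv_ge0 _)).
  apply: measurable_funM; last exact: measurable_dotv_powR.
  by apply: measurable_funX; apply: measurable_trial; rewrite invr_gt0.
have mpot' := measurable_weighted mu muL1 _ mpot.
have pot0 x : (0 <= (trial t k.+1%:R^-1 x ^+ 2 / enorm x ^+ 2 * mu x)%:E)%E.
  by rewrite lee_fin mulr_ge0 ?divr_ge0 ?sqr_ge0.
apply: (@le_trans _ _ (16%:E * \int[@lebesgue_rV R n]_x
    (trial t k.+1%:R^-1 x ^+ 2 / enorm x ^+ 2 * mu x)%:E)%E); last first.
  by rewrite EFinM lee_wpmul2l.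
rewrite -ge0_integralZl_EFin; [|exact: measurableT|by []|exact: mpot'|by []].
apply: (@le_trans _ _ (\int[@lebesgue_rV R n]_(x in D)
    (16%:E * (trial t k.+1%:R^-1 x ^+ 2 / enorm x ^+ 2 * mu x)%:E))%E); last first.
  apply: ge0_subset_integral.
  - exact: mD.
  - exact: measurableT.
  - exact: measurable_funeM.
  - by move=> x _; rewrite mule_ge0.
  - exact: subsetT.
apply: ge0_le_integral.
- exact: mD.
- exact: g0.
- exact: mg.
- by apply: measurable_funTS; exact: measurable_funeM.
- move=> x; rewrite /D /sqnorm_ball /= => xD; rewrite -EFinM lee_fin mulrA ler_wpM2r//.
  rewrite /w powR_inv1 ?dotv_ge0// enorm_sqr mulrA ler_wpM2r ?invr_ge0 ?dotv_ge0//.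
  rewrite /trial profile_sqrE mulrCA -[leLHS]mulr1; apply: ler_wpM2l; first exact: powR_ge0.
  rewrite hinge_subr; last by lra.
  have : 2^-1 <= 1 - dotv x x by lra.
  set m := 1 - _ => m2; rewrite (_ : 16 * m ^+ 4 = (2 * m) ^+ 4); last by ring.
  by apply: exprn_ege1; lra.
Qed.

(** The power weight is bounded away from the origin, where [mu] itself is
    locally integrable. *)
Lemma L1_loc_powR_of_ball {R : realType} {n : nat} {mu : 'rV[R]_n -> R} (p : R) :
  (forall x, 0 <= mu x) -> L1_loc (EFin \o mu) -> 0 <= p ->
  (\int[@lebesgue_rV R n]_(x in sqnorm_ball n (2^-1)%R)
    (dotv x x `^ (- p) * mu x)%:E < +oo)%E ->
  L1_loc (fun x : 'rV[R]_n => (mu x / enorm x `^ (2 * p))%:E).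
Proof.
move=> mu0 muL1 p0 hD.
have E : (fun x : 'rV[R]_n => (mu x / enorm x `^ (2 * p))%:E) =
    (fun x => (dotv x x `^ (- p) * mu x)%:E).
  by apply/funext => x; rewrite enorm_powR powRN mulrC.
have mf : measurable_fun [set: lebesgue_rV_type R n]
    (fun x => (dotv x x `^ (- p) * mu x)%:E).
  by apply: (measurable_weighted mu muL1); exact: measurable_dotv_powR.
rewrite E; split; first exact: mf.
move=> K cK.
set D := sqnorm_ball n _ in hD.
have mD : @measurable _ (lebesgue_rV_type R n) D.
  by apply: measurable_lebesgue_rV; exact: measurable_sqnorm_ball.
have mK : @measurable _ (lebesgue_rV_type R n) K.
  by apply: measurable_lebesgue_rV; exact: compact_measurable_rV.
pose f (x : lebesgue_rV_type R n) := (dotv x x `^ (- p) * mu x)%:E.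
have f0 x : (0 <= f x)%E by rewrite lee_fin mulr_ge0 ?powR_ge0.
have fD0 x : (0 <= (f \_ D) x)%E by rewrite patchE; case: ifP.
have mfD : measurable_fun [set: lebesgue_rV_type R n] (f \_ D).
  by apply/(measurable_restrictT _ mD); exact: measurable_funTS.
have mabs : measurable_fun [set: lebesgue_rV_type R n] (fun x => `|(mu x)%:E|%E).
  by apply: measurableT_comp; [exact: abse_measurable|exact: muL1.1].
pose C : R := 2^-1 `^ (- p).
have C0 : 0 <= C by exact: powR_ge0.
have mCabs : measurable_fun [set: lebesgue_rV_type R n] (fun x => (C%:E * `|(mu x)%:E|)%E).
  exact: measurable_funeM.
apply: (@le_lt_trans _ _
    (\int[@lebesgue_rV R n]_(x in K) ((f \_ D) x + C%:E * `|(mu x)%:E|))%E).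
  apply: ge0_le_integral.
  - exact: mK.
  - by move=> x _; exact: abse_ge0.
  - apply: measurable_funTS; apply: measurableT_comp; first exact: abse_measurable.
    exact: mf.
  - by apply: measurable_funTS; exact: emeasurable_funD.
  - move=> x _; rewrite gee0_abs; last exact: f0.
    rewrite patchE; case: ifPn => [_|].
      by rewrite leeDl// mule_ge0.
    rewrite notin_setE /D /sqnorm_ball /= => /negP; rewrite -ltNge => xD.
    rewrite add0e -EFinM lee_fin ger0_norm// ler_wpM2r//.
    by apply: ler_powRN => //; exact: ltW.
rewrite ge0_integralD; first last.
- by apply: measurable_funTS.
- by move=> x _; rewrite mule_ge0.
- by apply: measurable_funTS.
- by move=> x _.
- exact: mK.
apply: lte_add_pinfty.
  apply: le_lt_trans hD; rewrite [leRHS]integral_mkcond.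
  apply: ge0_subset_integral.
  - exact: mK.
  - exact: measurableT.
  - exact: mfD.
  - by move=> x _.
  - exact: subsetT.
rewrite ge0_integralZl_EFin;
  [|exact: mK|by move=> x _; exact: abse_ge0|by apply: measurable_funTS|exact: C0].
by rewrite lte_mul_pinfty//; exact: (muL1.2 _ cK).
Qed.

Lemma cut_weight_lty {R : realType} {n : nat} {mu : 'rV[R]_n -> R} (t : R) :
  (forall x, 0 <= mu x) -> L1_loc (EFin \o mu) ->
  L1_loc (fun x : 'rV[R]_n => (mu x / enorm x `^ (2 * t))%:E) ->
  (\int[@lebesgue_rV R n]_x (cut_weight t (dotv x x) * mu x)%:E < +oo)%E.
Proof.
move=> mu0 muL1 [mf fin]; apply: le_lt_trans (fin _ (compact_cube n 1)).
have mcube := measurable_lebesgue_rV _ (measurable_cube n (1 : R)).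
rewrite [leRHS]integral_mkcond; apply: ge0_le_integral.
- exact: measurableT.
- by move=> x _; rewrite lee_fin mulr_ge0 ?cut_weight_ge0.
- by apply: (measurable_weighted mu muL1); exact: measurable_cut_weight.
- apply/(measurable_restrictT _ mcube); apply: measurable_funTS.
  by apply: measurableT_comp; [exact: abse_measurable|exact: mf].
- move=> x _; rewrite patchE; have [xb|xb] := pselect (cube n 1 x).
    rewrite mem_set// gee0_abs lee_fin; last by rewrite divr_ge0 ?powR_ge0.
    rewrite enorm_powR -powRN mulrC ler_wpM2l// /cut_weight.
    by case: ifP => // _; exact: powR_ge0.
  rewrite memNset//; have [j xj] := notin_cube xb.
  have s1 : 1 < dotv x x.
    apply: lt_le_trans (dotv_coord x j).
    by rewrite -real_normK ?num_real// exprn_egt1.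
  by rewrite /cut_weight [dotv x x <= 1]leNgt s1 /= mul0r.
Qed.

(** * The constant is optimal *)

Theorem theorem3p1 (R : realType) (N : nat) (hN : (1 <= N)%N)
  (mu : 'rV[R]_N -> R) (gmu : 'rV[R]_N -> 'rV[R]_N)
  (mu_ge0 : forall x, 0 <= mu x)
  (sqrt_mu_H1 : H1_loc (fun x => Num.sqrt (mu x)))
  (gmuP : weak_gradient mu gmu)
  (* extended-real inverse: 0^-1 = +oo *)
  (mu_inv_L1 : L1_loc (fun x => ((mu x)%:E^-1)%E))
  (k1 k2 : R) (hk2 : 2 - N%:R < k2)
  (mu_ineq : forall eps : R, 0 < eps ->
    {ae @lebesgue_rV R N, forall x : 'rV[R]_N,
      dotv ((alpha_o N k2 / (eps + enorm x ^+ 2)) *: x) (gmu x) <=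
      (k1 + k2 * alpha_o N k2 / (eps + enorm x ^+ 2)) * mu x})
  (mu_delta : forall delta : R,
    L1_loc (fun x : 'rV[R]_N => (mu x / enorm x `^ delta)%:E) <->
    delta < N%:R + k2)
  (c : R) (hc : c_o (N%:R + k2) < c) :
  exists phi : 'rV[R]_N -> R, H1_weighted mu phi /\
    exists gphi : 'rV[R]_N -> 'rV[R]_N, weak_gradient phi gphi /\
      ~ hardy_inequality mu c k1 phi gphi.
Proof.
have muL1 : L1_loc (EFin \o mu) := gmuP.1.
pose t := (N%:R + k2 - 2) / 2.
have t0 : 0 < t by rewrite /t; lra.
have tc : t ^+ 2 < c := hc.
apply: contrapT => noex.
have hardy eps : 0 < eps -> hardy_inequality mu c k1 (trial t eps) (dtrial t eps).
  move=> eps0; apply: contrapT => nh; apply: noex.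
  exists (trial t eps); split; first exact: H1_weighted_trial.
  exists (dtrial t eps); split; [exact: weak_gradient_trial|exact: nh].
have Mlty : (\int[@lebesgue_rV R N]_x (cut_weight t (dotv x x) * mu x)%:E < +oo)%E.
  by apply: (cut_weight_lty t mu_ge0 muL1); apply/mu_delta; rewrite /t; lra.
have ek (k : nat) : 0 < k.+1%:R^-1 :> R by rewrite invr_gt0.
have bound k := hardy_trial_bound c k1 t _ hN mu_ge0 muL1 t0 (ek k) tc Mlty (hardy _ (ek k)).
have : ~ (N%:R + k2 < N%:R + k2) by rewrite ltxx.
(* The exponent of the singular weight is exactly the threshold, at which
   local integrability is excluded. *)
apply; rewrite {1}(_ : N%:R + k2 = 2 * (t + 1)); last by rewrite /t; lra.
apply/mu_delta; apply: (L1_loc_powR_of_ball _ mu_ge0 muL1); first by rewrite addr_ge0 ?ltW.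
exact: le_lt_trans (singular_weight_le t _ mu_ge0 muL1 t0 bound) (ltry _).
Qed.
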